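(* Let $X=[0,1]$, let $T$ be the Gauss map and $\mu$ the Gauss measure on $[0,1]$. Let $(k_m)_{m\in\mathbb{N}}$ be a non-decreasing sequence of natural numbers with $k_m\to\infty$, and let $\mathcal{B}=\{B_1\supset B_2\supset\cdots\}$ with $B_m=[0,1/k_m]$. If there exists $C_1>1$ such that for all but finitely many $m$ one has $$\log(1 + 1/k_m)\geq \frac{C_1\log\log m}{m},$$ then $\mathcal{H}_{\mathrm{e.a.}}(\mathcal{B})$ has full $\mu$-measure. On the other hand, if there exists $C_2<1/2$ such that $$\log(1 + 1/k_m)\leq \frac{C_2 \log\log m}{m}$$ for all but finitely many $m$, then $\mathcal{H}_{\mathrm{e.a.}}(\mathcal{B})$ has zero $\mu$-measure.
   Context: $\mathbb{N}=\{1,2,3,\dots\}$; $\log$ is the natural logarithm. The Gauss map is $T(x)=\frac1x-\lfloor\frac1x\rfloor$ for $x\in(0,1]$ and $T(0)=0$. The Gauss measure is $\mu(B)=\frac{1}{\log2}\int_B\frac{dx}{1+x}$; it is a $T$-invariant probability measure. Put $O_m(x)=\{Tx,T^2x,\dots,T^mx\}$. The eventually always hitting set is $$\mathcal{H}_{\mathrm{e.a.}}(\mathcal{B})=\{x\in X: O_m(x)\cap B_m\neq\varnothing\text{ for all but finitely many }m\in\mathbb{N}\}.$$ *)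

(* Defs.v *)
From HB Require Import structures.
From mathcomp Require Export all_boot all_order all_algebra.
From mathcomp Require Export all_classical all_reals all_analysis measurable_realfun.

Set Implicit Arguments.
Unset Strict Implicit.
Unset Printing Implicit Defensive.

Import Order.TTheory GRing.Theory Num.Theory.
Import numFieldNormedType.Exports.

Local Open Scope classical_set_scope.
Local Open Scope ring_scope.

(* O_m(x) = {T x, ..., T^m x}: the orbit starts at T x, not at x. *)
Definition orbit_segment (X : Type) (T : X -> X) (m : nat) (x : X) : set X :=
  [set iter i T x | i in [set i | (1 <= i <= m)%N]].

(* The phase space is the subset X of the ambient type U. *)
Definition eventually_always_hitting (U : Type) (X : set U) (T : U -> U)
    (B : nat -> set U) : set U :=
  [set x | X x /\ \forall m \near \oo, orbit_segment T m x `&` B m !=set0].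

(* Only the restriction to `[0, 1] matters; it maps `[0, 1] to itself. *)
Definition gauss_map (R : realType) (x : R) : R :=
  if x == 0 then 0 else x^-1 - (Num.floor x^-1)%:~R.

(* The Gauss measure, as a probability on the line supported by `[0, 1]. *)
Definition gauss_measure (R : realType) (A : set R) : \bar R :=
  ((ln 2)^-1%:E *
    \int[@lebesgue_measure R]_(x in A `&` `[0%R, 1%R]) ((1 + x)^-1)%:E)%E.

Section gauss_measure_probability.
Variable R : realType.

Let dens_ge0 (A : set R) x : (A `&` `[0, 1]) x -> (0 <= ((1 + x)^-1)%:E)%E.
Proof.
by move=> [_] /=; rewrite in_itv/= => /andP[x0 _]; rewrite lee_fin invr_ge0 addr_ge0.
Qed.

Let ln2_gt0 : 0 < ln 2 :> R.
Proof. by rewrite ln_gt0// ltr1n. Qed.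

Let dens_continuous : {within `[0, 1], continuous (fun x : R => (1 + x)^-1)}.
Proof.
apply: continuous_in_subspaceT => x; rewrite inE/= in_itv/= => /andP[x0 _].
apply: continuousV; first by rewrite gt_eqF// ltr_pwDl.
by apply: continuousD; [exact: cst_continuous|exact: cvg_id].
Qed.

Let dens_measurable :
  measurable_fun (`[0, 1] : set R) (EFin \o (fun x : R => (1 + x)^-1)).
Proof.
by apply/measurable_EFinP; apply: subspace_continuous_measurable_fun.
Qed.

Let gauss0 : gauss_measure (set0 : set R) = 0%E.
Proof. by rewrite /gauss_measure set0I integral_set0 mule0. Qed.

Let gauss_ge0 (A : set R) : (0 <= gauss_measure A)%E.
Proof.
apply: mule_ge0; first by rewrite lee_fin invr_ge0 ltW.
by apply: integral_ge0 => x; exact: dens_ge0.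
Qed.

Let gauss_sigma_additive : semi_sigma_additive (@gauss_measure R).
Proof.
move=> /= F mF tF mUF; apply: cvg_toP.
  apply: ereal_nondecreasing_is_cvgn => m n mn.
  by apply: lee_sum_nneg_natr => // k _ _; exact: gauss_ge0.
rewrite /gauss_measure setI_bigcupl ge0_integral_bigcup//=.
- rewrite nneseriesZl//= => n _.
  by apply: integral_ge0 => x; exact: dens_ge0.
- by move=> k; apply: measurableI; [exact: mF|exact: measurable_itv].
- by rewrite -setI_bigcupl; exact: measurable_funS dens_measurable.
- by rewrite -setI_bigcupl => x; exact: dens_ge0.
- exact: trivIset_setIr.
Qed.

HB.instance Definition _ := isMeasure.Build _ _ _ (@gauss_measure R)
  gauss0 gauss_ge0 gauss_sigma_additive.

Let gauss_setT : gauss_measure [set: R] = 1%E.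
Proof.
rewrite /gauss_measure setTI.
have d (x : R) : 0 <= x -> is_derive x 1 (fun y : R => ln (1 + y)) (1 + x)^-1.
  move=> x0; have x1 : 0 < 1 + x by rewrite ltr_pwDl.
  have := is_derive1_ln x1 => dl.
  have -> : (1 + x)^-1 = (1 + x)^-1 *: (1 : R) by rewrite scaler1.
  apply: is_derive1_comp.
  by apply: is_derive_eq; rewrite add0r.
rewrite (@continuous_FTC2 _ _ (fun y : R => ln (1 + y)))//=.
- by rewrite addr0 ln1 sube0 -EFinM mulVf// gt_eqF.
- have c (x : R) : 0 <= x -> {for x, continuous (fun y : R => ln (1 + y))}.
    move=> x0; apply/differentiable_continuous/derivable1_diffP.
    by have [] := d _ x0.
  split.
  + by move=> x; rewrite in_itv/= => /andP[x0 _]; have [] := d x (ltW x0).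
  + by apply: cvg_at_right_filter; exact: c.
  + by apply: cvg_at_left_filter; exact: c.
- move=> x; rewrite in_itv/= => /andP[x0 _].
  by rewrite derive1E; have [_ ->] := d x (ltW x0).
Qed.

HB.instance Definition _ := @Measure_isProbability.Build _ _ R
  (@gauss_measure R) gauss_setT.

End gauss_measure_probability.

Lemma measurable_gauss_map (R : realType) :
  measurable_fun [set: R] (@gauss_map R).
Proof.
apply: measurable_fun_if => //=; first exact: measurable_fun_eqr.
rewrite setTI (_ : _ @^-1` _ = [set x : R | x != 0]); last first.
  by apply/seteqP; split=> x /=; case: (x == 0).
have mV : measurable_fun [set x : R | x != 0] (fun x : R => x^-1).
  apply: open_continuous_measurable_fun; first exact: open_neq.
  by move=> x; rewrite inE => x0; exact: inv_continuous.
apply: measurable_funB => //.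
apply: (measurable_comp (F := setT) (f := fun y : measurableTypeR R => (Num.floor y)%:~R : measurableTypeR R)) => //.
by apply: nondecreasing_measurable => // x y xy; rewrite ler_int le_floor.
Qed.

Lemma measurable_eventually_always_hitting d (U : measurableType d) (X : set U)
    (T : U -> U) (B : nat -> set U) :
  measurable X -> measurable_fun setT T -> (forall m, measurable (B m)) ->
  measurable (eventually_always_hitting X T B).
Proof.
move=> mX mT mB.
have mi i : measurable_fun setT (iter i T).
  by elim: i => [|i IH]; [exact: measurable_id|exact: measurableT_comp].
rewrite (_ : eventually_always_hitting _ _ _ = X `&` \bigcup_N \bigcap_(m in [set m | (N <= m)%N])
    \bigcup_(i in [set i | (1 <= i <= m)%N]) (iter i T @^-1` B m)).
  apply: measurableI => //; apply: bigcupT_measurable => N.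
  apply: bigcap_measurableType => m _; apply: bigcup_measurable => i _.
  by rewrite -[X in measurable X]setTI; exact: mi.
apply/seteqP; split=> x [Xx].
  move=> [N _ h]; split=> //; exists N => // m /h [_ [[i im <-] Bi]].
  by exists i.
move=> [N _ h]; split=> //; exists N => // m /h [i im Bi].
by exists (iter i T x); split => //; exists i.
Qed.

(* Main.v *)
(** On a continued fraction cylinder of rank n, the law of T^n x is the image of
    Lebesgue measure on [0,1] under u |-> u / (1 + s - s u), where
    s = q_(n-1) / q_n.  In the coordinate u, the branch 1/x = a + y of T is affine
    and sends the law of parameter s to the law of parameter 1/(a+s).  So, given the
    past, the next point falls in [0,1/k] with probability (1+s)/(k+s), which lies
    between 1/k and 2/(k+1), and all of [0,1/k] is missed during m steps with
    probability between (1 - 2/(k+1))^m and (1 - 1/k)^m.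

    If log(1 + 1/k_m) >= C1 loglog m / m, the upper bound is summable along a
    geometric sequence of times m, and Borel-Cantelli concludes.  In the other
    case, take the times m_j = (j!)^4: hitting B_(m_(j+1)) before time m_j has
    summable probability, while the conditional probability of missing it between
    m_j and m_(j+1) is at least a multiple of 1/(j+1), so almost surely infinitely
    many such blocks are missed. *)

Require Import Defs.
From mathcomp Require Import all_boot all_order all_algebra.
From mathcomp Require Import all_classical all_reals all_analysis measurable_realfun.
From mathcomp Require Import ring lra.

Import Order.TTheory GRing.Theory Num.Theory.
Import numFieldNormedType.Exports.

Local Open Scope classical_set_scope.
Local Open Scope ring_scope.

Set Implicit Arguments.
Unset Strict Implicit.
Unset Printing Implicit Defensive.

(** By uniqueness of Lebesgue measure: the pushforward under the affine map, divided by c, gives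
    each half-open interval its length. *)
Lemma lebesgue_preimage_affine (R : realType) (b c : R) (A : set R) :
  0 < c -> measurable A ->
  lebesgue_measure ((fun u => (b - u) / c) @^-1` A) = (c%:E * lebesgue_measure A)%E.
Proof.
move=> c0 mA.
pose f (u : measurableTypeR R) : measurableTypeR R := (b - u) / c.
have mf : measurable_fun [set: measurableTypeR R] f.
  by apply: measurable_funM => //; apply: measurable_funB.
have ci0 : 0 <= c^-1 by rewrite invr_ge0 ltW.
pose nu : {measure set (measurableTypeR R) -> \bar R} :=
  @measure_function_pushforward__canonical__measure_function_Measure
    _ _ _ _ _ (@lebesgue_measure R) f mf.
pose mu := mscale (NngNum ci0) nu.
rewrite (@lebesgue_measure_unique R mu _ _ mA).
  rewrite /mu /mscale /= /nu /= /pushforward muleA -EFinM divff ?mul1e//.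
  exact: lt0r_neq0.
move=> X /ocitvP [->|[[x y]/= xy ->]]; first by rewrite !measure0.
  rewrite /mu /mscale /nu /= /pushforward.
  have -> : f @^-1` `]x, y] = `[b - c * y, b - c * x[%classic.
    apply/seteqP; split => u /=; rewrite /f !in_itv/= ltr_pdivlMr// ler_pdivrMr//.
      by move=> /andP[h1 h2]; apply/andP; split; lra.
    by move=> /andP[h1 h2]; apply/andP; split; lra.
  rewrite !lebesgue_measure_itv/= !lte_fin xy ltrD2l ltrN2 ltr_pM2l// xy.
  rewrite -!EFinD -EFinM; congr EFin; field; exact: lt0r_neq0.
Qed.

(** * Laws of T^n x on cylinders *)

Definition mobius_chart (R : realType) (s u : R) : R := u / (1 + s - s * u).

Definition mobius_law (R : realType) (s : R) (A : set R) : \bar R :=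
  lebesgue_measure (`[0, 1] `&` mobius_chart s @^-1` A).

Lemma mobius_chart_den_ge1 (R : realType) (s u : R) :
  0 <= s -> 0 <= u <= 1 -> 1 <= 1 + s - s * u.
Proof. move=> s0 u01; nra. Qed.

Lemma mobius_chart_itv (R : realType) (s u : R) :
  0 <= s -> 0 <= u <= 1 -> 0 <= mobius_chart s u <= 1.
Proof.
move=> s0 u01; have d1 := mobius_chart_den_ge1 s0 u01.
have d0 : 0 < 1 + s - s * u by lra.
by rewrite /mobius_chart ler_pdivrMr// divr_ge0 ?(ltW d0)//; nra.
Qed.

Lemma measurable_mobius_preimage (R : realType) (s : R) (A : set R) :
  0 <= s -> measurable A -> measurable (`[0, 1] `&` mobius_chart s @^-1` A).
Proof.
move=> s0 mA.
have mc : measurable_fun (`[0, 1] : set R) (mobius_chart s).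
  apply: subspace_continuous_measurable_fun => //.
  apply: continuous_in_subspaceT => x; rewrite inE/= in_itv/= => x01.
  have d1 := mobius_chart_den_ge1 s0 x01.
  rewrite /continuous_at /mobius_chart.
  apply: cvgM; first exact: cvg_id.
  apply: cvgV; first by rewrite gt_eqF// (lt_le_trans ltr01).
  apply: cvgB; first exact: cvg_cst.
  by apply: cvgM; [exact: cvg_cst|exact: cvg_id].
exact: mc.
Qed.

Lemma le_mobius_law (R : realType) (s : R) (A B : set R) :
  0 <= s -> measurable A -> measurable B ->
  (forall x, 0 <= x <= 1 -> A x -> B x) ->
  (mobius_law s A <= mobius_law s B)%E.
Proof.
move=> s0 mA mB AB; apply: le_measure; rewrite ?inE; try exact: measurable_mobius_preimage.
move=> u /= [u01 Au]; split => //; apply: AB => //.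
by apply: mobius_chart_itv => //; rewrite in_itv in u01.
Qed.

Lemma mobius_lawU (R : realType) (s : R) (A B : set R) :
  0 <= s -> measurable A -> measurable B ->
  (mobius_law s (A `|` B) <= mobius_law s A + mobius_law s B)%E.
Proof.
move=> s0 mA mB; rewrite /mobius_law preimage_setU setIUr.
by apply: measureU2; exact: measurable_mobius_preimage.
Qed.

Lemma mobius_law_le1 (R : realType) (s : R) (A : set R) :
  0 <= s -> measurable A -> (mobius_law s A <= 1)%E.
Proof.
move=> s0 mA; have -> : (1 = lebesgue_measure (`[0%R, 1%R] : set R))%E.
  by rewrite lebesgue_measure_itv/= lte01 oppr0 adde0.
by apply: le_measure; rewrite ?inE; [exact: measurable_mobius_preimage
  |exact: measurable_itv|exact: subIsetl].
Qed.

(** Solving u / (1 + s - s u) <= t for u gives u <= (1 + s) t / (1 + s t), so the set in question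
    lies in an initial interval of that length. *)
Lemma mobius_law_initial (R : realType) (s t : R) :
  0 <= s -> 0 < t -> (mobius_law s `[0%R, t] <= ((1 + s) * t / (1 + s * t))%:E)%E.
Proof.
move=> s0 t0; set c := (X in (X%:E)%E).
have c0 : 0 < c by apply: divr_gt0; nra.
have -> : (c%:E = lebesgue_measure (`[0%R, c] : set R))%E.
  by rewrite lebesgue_measure_itv/= lte_fin c0 oppr0 adde0.
apply: le_measure; rewrite ?inE; [exact: measurable_mobius_preimage|exact: measurable_itv|].
move=> u /=; rewrite !in_itv/= => -[u01 /andP[_]].
have d1 := mobius_chart_den_ge1 s0 u01.
rewrite /mobius_chart /c ler_pdivrMr; last lra.
rewrite ler_pdivlMr; last nra.
by case/andP: u01 => -> _ /= ?; nra.
Qed.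

Lemma gauss_map_branch (R : realType) (a : nat) (x : R) : (0 < a)%N ->
  a.+1%:R^-1 < x <= a%:R^-1 -> gauss_map x = x^-1 - a%:R.
Proof.
move=> a0 /andP[xa ax]; have a1 : 0 < a%:R :> R by rewrite ltr0n.
have x0 : 0 < x by apply: lt_trans xa; rewrite invr_gt0 ltr0n.
rewrite /gauss_map gt_eqF//; congr (_ - _).
rewrite (@floor_def _ _ a%:Z) ?mulrz_nat//.
rewrite -pmulrn intrD -!pmulrn -lef_pV2 ?posrE ?invr_gt0// invrK ax/=.
by rewrite -ltf_pV2 ?posrE ?invr_gt0// ?addr_gt0// invrK natr1.
Qed.

(** In the coordinate u, the branch lies in the interval from (1 + s) / (a + s + 1) to (1 + s) / (a
    + s). The decreasing affine map of this interval onto [0, 1] turns 1/x - a into the chart of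
    parameter 1 / (a + s). The factor is the length of the interval. *)
Lemma mobius_law_branch (R : realType) (s : R) (a : nat) (A : set R) :
  0 <= s -> (0 < a)%N -> measurable A ->
  (mobius_law s (`](a.+1%:R^-1)%R, (a%:R^-1)%R] `&` @gauss_map R @^-1` A) <=
   ((1 + s) / ((a%:R + s) * (a%:R + s + 1)))%:E * mobius_law (a%:R + s)^-1 A)%E.
Proof.
move=> s0 a0 mA.
have a1 : 1 <= a%:R :> R by rewrite ler1n.
have s'0 : 0 <= (a%:R + s)^-1 by rewrite invr_ge0; lra.
set c := (1 + s) / _; have c0 : 0 < c by apply: divr_gt0; nra.
have mV := measurable_mobius_preimage s'0 mA.
rewrite /(mobius_law _^-1) -(lebesgue_preimage_affine ((1 + s) / (a%:R + s)) c0 mV).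
have mTA : measurable (`]a.+1%:R^-1 : R, a%:R^-1] `&` @gauss_map R @^-1` A).
  apply: measurableI; first exact: measurable_itv.
  by rewrite -[X in measurable X]setTI; exact: measurable_gauss_map.
apply: le_measure; rewrite ?inE.
- exact: measurable_mobius_preimage.
- have mf : measurable_fun [set: R] (fun u : R => ((1 + s) / (a%:R + s) - u) / c).
    by apply: measurable_funM => //; apply: measurable_funB.
  by rewrite -[X in measurable X]setTI; apply: mf.
move=> u [/=]; rewrite in_itv/= => u01 []; rewrite in_itv/=; set x := mobius_chart s u => xa.
have d1 := mobius_chart_den_ge1 s0 u01.
rewrite (gauss_map_branch a0 xa).
(* At u = 0 the chart gives x = 0, which lies in no branch. *)
have u0 : 0 < u.
  rewrite lt_neqAle; case/andP: u01 => -> _; rewrite andbT; apply/eqP => u0.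
  by move: xa; rewrite /x /mobius_chart -u0 mul0r ltNge invr_ge0 ler0n.
have as0 : 0 < a%:R + s by lra.
case/andP: xa => ax xa.
(* [h1] and [h2] are the two ends of the branch, read in the coordinate u. *)
have h1 : u * (a%:R + s) <= 1 + s.
  move: xa; rewrite /x /mobius_chart -[a%:R^-1]div1r ler_pdivlMr ?ltr0n//.
  rewrite mulrAC ler_pdivrMr; lra.
have h2 : 1 + s <= u * (a%:R + s + 1).
  move: ax; rewrite /x /mobius_chart -[_.+1%:R^-1]div1r ltr_pdivrMr ?ltr0n//.
  rewrite mulrAC ltr_pdivlMr -?natr1; lra.
have s1 : 0 < 1 + s by lra.
set v := (X in X / c).
have -> : x^-1 - a%:R = mobius_chart (a%:R + s)^-1 (((1 + s) / (a%:R + s) - u) / c).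
  rewrite /x /mobius_chart /c; field.
  have as1 : 0 < u * (a%:R + s) * (a%:R + s + 1) by rewrite !mulr_gt0//; lra.
  by do ?[apply/andP; split]; apply: lt0r_neq0; lra.
move=> Ax; split => //; rewrite in_itv/= ler_pdivlMr// mul0r ler_pdivrMr// mul1r /v /c.
rewrite subr_ge0 ler_pdivlMr// h1/= lerBlDr -lerBlDl.
have -> : (1 + s) / (a%:R + s) - (1 + s) / ((a%:R + s) * (a%:R + s + 1)) =
    (1 + s) / (a%:R + s + 1).
  by field; rewrite !gt_eqF//; lra.
by rewrite ler_pdivrMr//; lra.
Qed.

(** Uniformity over s in [0, 1] makes this an induction hypothesis that survives conditioning: every
    branch sends the parameter to 1 / (a + s), again in [0, 1]. *)
Definition mobius_bounded (R : realType) (A : set R) (alpha : R) : Prop :=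
  forall s, 0 <= s -> s <= 1 -> (mobius_law s A <= alpha%:E)%E.

Lemma mobius_bounded_ge0 (R : realType) (A : set R) (alpha : R) :
  mobius_bounded A alpha -> 0 <= alpha.
Proof.
move=> /(_ 0 (lexx _) ler01); rewrite -lee_fin.
by apply: le_trans; exact: measure_ge0.
Qed.

(** The weight of branch a is (1 + s) / (a + s) - (1 + s) / (a + 1 + s), so the sum over a
    telescopes. *)
Lemma mobius_law_finite_branches (R : realType) (s alpha : R) (k M : nat) (A : set R) :
  0 <= s -> (0 < k <= M)%N -> measurable A ->
  mobius_bounded A alpha ->
  (mobius_law s (`](M%:R^-1)%R, (k%:R^-1)%R] `&` @gauss_map R @^-1` A) <=
   (alpha * ((1 + s) / (k%:R + s) - (1 + s) / (M%:R + s)))%:E)%E.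
Proof.
move=> s0 /andP[k0 kM] mA hA.
have mT (i : interval R) : measurable ([set` i] `&` @gauss_map R @^-1` A).
  apply: measurableI; first exact: measurable_itv.
  by rewrite -[X in measurable X]setTI; exact: measurable_gauss_map.
have k1 : 1 <= k%:R :> R by rewrite ler1n.
have -> : M = (k + (M - k))%N by rewrite subnKC.
elim: (M - k)%N => [|n IH].
  by rewrite addn0 set_itvoc0 set0I subrr mulr0 /mobius_law preimage_set0 setI0 measure0.
have kn1 : 1 <= (k + n)%:R :> R by rewrite ler1n addn_gt0 k0.
set T1 := (X in mobius_law s X) in IH.
set T2 : set R := (`](((k + n).+1)%:R^-1)%R, ((k + n)%:R^-1)%R] `&` @gauss_map R @^-1` A).
have mT1 : measurable T1 by exact: mT.
have mT2 : measurable T2 by exact: mT.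
have hU : (mobius_law s (T1 `|` T2) <= mobius_law s T1 + mobius_law s T2)%E.
  exact: mobius_lawU.
have hb : (mobius_law s T2 <=
    ((1 + s) / (((k + n)%:R + s) * ((k + n)%:R + s + 1)) * alpha)%:E)%E.
  apply: (le_trans (mobius_law_branch s0 _ mA)); first by rewrite addn_gt0 k0.
  rewrite [leRHS]EFinM; apply: lee_wpmul2l; first by rewrite lee_fin divr_ge0//; nra.
  by apply: hA; [rewrite invr_ge0; lra|rewrite invf_le1; lra].
apply: (@le_trans _ _ (mobius_law s (T1 `|` T2))).
  have mTn := mT `](k + n.+1)%:R^-1, k%:R^-1].
  apply: le_mobius_law => //; first exact: measurableU.
  move=> x x01 /= [+ Ax]; rewrite !in_itv/= => /andP[h1 h2].
  have [h|h] := ltP (k + n)%:R^-1 x; [left|right]; split => //=; rewrite in_itv/=.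
    by rewrite h.
  by rewrite -addnS h1.
apply: (le_trans hU); apply: (le_trans (leeD IH hb)); rewrite -EFinD lee_fin addnS -natr1.
rewrite le_eqVlt; apply/orP; left; apply/eqP; field.
have n0 : 0 <= n%:R :> R by [].
by do ?[apply/andP; split]; apply: lt0r_neq0; lra.
Qed.

(** One step of the Markov property: the weight of [0, 1/k] is (1 + s) / (k + s), and on either side
    of 1/k the image point follows, branch by branch, a law controlled by [alpha] or [beta]. The
    infinitely many branches near 0 are cut off at the cost of an arbitrary e. *)
Lemma mobius_law_step (R : realType) (s alpha beta : R) (k : nat) (A B C : set R) :
  0 <= s -> (0 < k)%N -> measurable A -> measurable B -> measurable C ->
  mobius_bounded A alpha ->
  mobius_bounded B beta ->
  (forall x, 0 <= x <= k%:R^-1 -> C x -> A (gauss_map x)) ->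
  (forall x, k%:R^-1 < x <= 1 -> C x -> B (gauss_map x)) ->
  (mobius_law s C <= (alpha * ((1 + s) / (k%:R + s))
                       + beta * (1 - (1 + s) / (k%:R + s)))%:E)%E.
Proof.
move=> s0 k0 mA mB mC hA hB CA CB.
have k1 : 1 <= k%:R :> R by rewrite ler1n.
have mT (i : interval R) D : measurable D -> measurable ([set` i] `&` @gauss_map R @^-1` D).
  move=> mD; apply: measurableI; first exact: measurable_itv.
  by rewrite -[X in measurable X]setTI; exact: measurable_gauss_map.
have alpha0 := mobius_bounded_ge0 hA.
apply/lee_addgt0Pr => e e0.
(* The discarded interval [0, 1/(M+1)] has mass at most (1 + s) / (M + 1 + s) <= e; adding k ensures
   k <= M + 1. *)
set M := (k + Num.truncn ((1 + s) / e))%N.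
have M1 : (1 + s) / e < M.+1%:R.
  apply: (@lt_le_trans _ _ (Num.truncn ((1 + s) / e)).+1%:R).
    by apply: truncnS_gt.
  by rewrite ler_nat /M -addnS leq_addl.
have M0 : 0 < M.+1%:R :> R by rewrite ltr0n.
pose I0 : set R := `[0, M.+1%:R^-1]%classic.
pose I1 : set R := `]M.+1%:R^-1, k%:R^-1] `&` @gauss_map R @^-1` A.
pose I2 : set R := `]k%:R^-1, 1%:R^-1] `&` @gauss_map R @^-1` B.
have mI0 : measurable I0 by exact: measurable_itv.
have mI1 : measurable I1 by exact: mT.
have mI2 : measurable I2 by exact: mT.
have h0 : (mobius_law s I0 <= e%:E)%E.
  apply: (le_trans (mobius_law_initial s0 _)); first by rewrite invr_gt0.
  rewrite lee_fin.
  rewrite (_ : _ / _ = (1 + s) / (M.+1%:R + s)); last first.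
    by field; rewrite !gt_eqF//; lra.
  rewrite ler_pdivrMr; last lra.
  move: M1; rewrite ltr_pdivrMr//; nra.
have h1 := mobius_law_finite_branches s0 (_ : (0 < k <= M.+1)%N) mA hA.
have h2 := mobius_law_finite_branches s0 (_ : (0 < 1 <= k)%N) mB hB.
have hU : (mobius_law s (I0 `|` I1 `|` I2) <=
    mobius_law s I0 + mobius_law s I1 + mobius_law s I2)%E.
  apply: le_trans (mobius_lawU _ _ _) _ => //; first exact: measurableU.
  by rewrite leeD2r//; exact: mobius_lawU.
apply: (@le_trans _ _ (mobius_law s (I0 `|` I1 `|` I2))).
  apply: le_mobius_law => //; first by apply: measurableU => //; exact: measurableU.
  move=> x /andP[x0 x1] Cx.
  have [xM|xM] := leP x M.+1%:R^-1; first by left; left; rewrite /I0/= in_itv/= x0.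
  have [xk|xk] := leP x k%:R^-1.
    left; right; split; first by rewrite /= in_itv/= xM.
    by apply: CA => //; rewrite x0.
  right; split; first by rewrite /= in_itv/= xk invr1.
  by apply: CB => //; rewrite xk.
apply: (le_trans hU).
apply: (@le_trans _ _ (e%:E
  + (alpha * ((1 + s) / (k%:R + s) - (1 + s) / (M.+1%:R + s)))%:E
  + (beta * ((1 + s) / (1 + s) - (1 + s) / (k%:R + s)))%:E)%E).
  apply: leeD; last by apply: h2.
  by apply: leeD => //; apply: h1; rewrite k0 ltnW// ltnS /M leq_addr.
rewrite -!EFinD lee_fin divff; last by rewrite gt_eqF; lra.
have : 0 <= alpha * ((1 + s) / (M.+1%:R + s)).
  by apply: mulr_ge0 => //; apply: divr_ge0; lra.
rewrite mulrBr; lra.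
Qed.

(** * Missing and hitting [0, 1/k] *)

(** Times run from 0 to m - 1, which suits induction on m; orbits starting at T x are recovered by
    one more preimage. Only the upper end of [0, 1/k] is tested, as iterates of points of [0, 1] are
    nonnegative. *)
Definition no_hit (R : realType) (k m : nat) : set R :=
  [set x | forall i, (i < m)%N -> k%:R^-1 < iter i (@gauss_map R) x].

Definition hit (R : realType) (k m : nat) : set R :=
  [set x | exists2 i, (i < m)%N & iter i (@gauss_map R) x <= k%:R^-1].

Lemma measurable_iter_gauss_map (R : realType) (i : nat) (A : set R) :
  measurable A -> measurable (iter i (@gauss_map R) @^-1` A).
Proof.
move=> mA; elim: i => [//|i IH].
rewrite (_ : _ @^-1` _ = @gauss_map R @^-1` (iter i (@gauss_map R) @^-1` A)).
  by rewrite -[X in measurable X]setTI; exact: measurable_gauss_map.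
by apply/seteqP; split => x; rewrite /preimage/= -iterS iterSr.
Qed.

Lemma measurable_no_hit (R : realType) (k m : nat) : measurable (@no_hit R k m).
Proof.
rewrite (_ : no_hit _ _ = \bigcap_(i in [set i | (i < m)%N])
    (iter i (@gauss_map R) @^-1` `]k%:R^-1, +oo[)).
  apply: bigcap_measurableType => i _.
  by apply: measurable_iter_gauss_map; exact: measurable_itv.
apply/seteqP; split => x h i /h; rewrite /preimage/=.
  by rewrite in_itv/= andbT.
by rewrite in_itv/= andbT.
Qed.

Lemma measurable_hit (R : realType) (k m : nat) : measurable (@hit R k m).
Proof.
rewrite (_ : hit k m = ~` @no_hit R k m).
  by apply: measurableC; exact: measurable_no_hit.
apply/seteqP; split => x.
  by move=> [i im h] /(_ i im); rewrite ltNge h.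
move=> h; apply: contrapT => h'; apply: h => i im; rewrite ltNge; apply/negP => hi.
by apply: h'; exists i.
Qed.

Lemma mobius_bounded_set0 (R : realType) : mobius_bounded (set0 : set R) 0.
Proof. by move=> s s0 s1; rewrite /mobius_law preimage_set0 setI0 measure0. Qed.

Lemma mobius_bounded_setT (R : realType) : mobius_bounded (setT : set R) 1.
Proof. by move=> s s0 s1; exact: mobius_law_le1. Qed.

(** Substitute for invariance of the measure: with the same bound on both sides of the step, the two
    weights add up to 1. *)
Lemma mobius_bounded_preimage (R : realType) (A : set R) (alpha : R) (n : nat) :
  measurable A -> mobius_bounded A alpha ->
  mobius_bounded (iter n (@gauss_map R) @^-1` A) alpha.
Proof.
move=> mA hA; elim: n => [//|n IH] s s0 s1.
have mn := measurable_iter_gauss_map n mA.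
have := @mobius_law_step R s alpha alpha 1 _ _ (iter n.+1 (@gauss_map R) @^-1` A) s0 isT mn mn
  (measurable_iter_gauss_map n.+1 mA) IH IH.
rewrite -mulrDr addrC subrK mulr1; apply => x _; by rewrite /preimage/= -iterS iterSr.
Qed.

(** A first point in [0, 1/k] contributes nothing; the other points have weight 1 - (1 + s) / (k +
    s) <= 1 - 1/k. *)
Lemma mobius_bounded_no_hit (R : realType) (k m : nat) : (0 < k)%N ->
  mobius_bounded (@no_hit R k m) ((1 - k%:R^-1) ^+ m).
Proof.
move=> k0; have k1 : 1 <= k%:R :> R by rewrite ler1n.
have kV : k%:R^-1 <= 1 :> R by rewrite invf_le1//; lra.
elim: m => [|m IH] s s0 s1.
  by rewrite expr0; apply: mobius_law_le1 => //; exact: measurable_no_hit.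
have := @mobius_law_step R s 0 _ k set0 _ (no_hit k m.+1) s0 k0 measurable0
  (measurable_no_hit k m) (measurable_no_hit k m.+1) (@mobius_bounded_set0 R) IH.
move=> h; apply: le_trans (h _ _) _ => //.
- by move=> x /andP[_ xk] /(_ 0%N isT) /=; rewrite ltNge xk.
- by move=> x _ hx i im; rewrite -iterSr; exact: hx.
rewrite mul0r add0r lee_fin exprS mulrC ler_wpM2r ?exprn_ge0 ?subr_ge0//.
rewrite lerD2l lerN2 ler_pdivlMr; last lra.
by rewrite mulrDr mulVf ?gt_eqF ?ltr0n// lerD2l ler_piMl.
Qed.

(** Carrying the later event A along lets successive blocks be chained. After a hit at time 0 only A
    remains, with bound [alpha]; otherwise induct. The weight of a hit, (1 + s) / (k + s), increases
    with s up to 2 / (k + 1). *)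
Lemma mobius_bounded_hit (R : realType) (k m : nat) (A : set R) (alpha : R) :
  (0 < k)%N -> measurable A -> mobius_bounded A alpha ->
  mobius_bounded (hit k m `&` iter m (@gauss_map R) @^-1` A)
    (alpha * (1 - (1 - 2 / (k%:R + 1)) ^+ m)).
Proof.
move=> k0 mA hA; have k1 : 1 <= k%:R :> R by rewrite ler1n.
have alpha0 := mobius_bounded_ge0 hA.
have r0 : 0 <= 1 - 2 / (k%:R + 1) :> R by rewrite subr_ge0 ler_pdivrMr; lra.
have mh n : measurable (@hit R k n `&` iter n (@gauss_map R) @^-1` A).
  by apply: measurableI; [exact: measurable_hit|exact: measurable_iter_gauss_map].
elim: m => [|m IH] s s0 s1.
  rewrite expr0 subrr mulr0 (_ : _ `&` _ = set0); first exact: mobius_bounded_set0.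
  by apply/seteqP; split => x // [[]].
have := @mobius_law_step R s _ _ k _ _ _ s0 k0 (measurable_iter_gauss_map m mA)
  (mh m) (mh m.+1) (mobius_bounded_preimage m mA hA) IH.
move=> h; apply: le_trans (h _ _) _ => //.
- by move=> x _ [_]; rewrite /preimage/= -iterS iterSr.
- move=> x /andP[kx _] [[[|i] im hi]].
    by move: hi; rewrite /= leNgt kx.
  by rewrite /preimage/= -iterS iterSr => Ax; split => //; exists i; rewrite // -iterSr.
rewrite lee_fin; set F := (1 + s) / _; set r := 1 - 2 / _ in r0 *.
have rF : r <= 1 - F.
  rewrite /r /F lerD2l lerN2 ler_pdivrMr; last lra.
  rewrite mulrAC ler_pdivlMr; last lra.
  nra.
have rm : 0 <= r ^+ m by rewrite exprn_ge0.
rewrite exprS -subr_ge0.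
have -> : alpha * (1 - r * r ^+ m) - (alpha * F + alpha * (1 - r ^+ m) * (1 - F)) =
  alpha * r ^+ m * (1 - F - r) by ring.
by rewrite !mulr_ge0// subr_ge0.
Qed.

(** * Null sets of the Gauss measure and Borel-Cantelli *)

Lemma mobius_law0 (R : realType) (A : set R) :
  mobius_law 0 A = lebesgue_measure (`[0, 1] `&` A).
Proof.
congr lebesgue_measure; apply/seteqP; split => x [x01]; rewrite /preimage/= /mobius_chart.
  by rewrite mul0r subr0 addr0 divr1.
by move=> Ax; split => //=; rewrite mul0r subr0 addr0 divr1.
Qed.

(** The Gauss measure has a density with respect to Lebesgue measure on [0, 1], which is the law of
    parameter 0. *)
Lemma gauss_measure_null (R : realType) (A : set R) : measurable A ->
  mobius_law 0 A = 0%E -> gauss_measure A = 0%E.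
Proof.
move=> mA; rewrite mobius_law0 => A0; rewrite /gauss_measure null_set_integral ?mule0//.
- by apply: measurableI.
- have dm : measurable_fun (`[0, 1] : set R) (EFin \o (fun x : R => (1 + x)^-1)).
    apply/measurable_EFinP; apply: subspace_continuous_measurable_fun => //.
    apply: continuous_in_subspaceT => x; rewrite inE/= in_itv/= => /andP[x0 _].
    apply: continuousV; first by rewrite gt_eqF// ltr_pwDl.
    by apply: continuousD; [exact: cst_continuous|exact: cvg_id].
  exact: measurable_funS dm.
- by rewrite setIC.
Qed.

(* First Borel-Cantelli lemma, the sum of the measures being bounded by telescoping. *)
Lemma null_of_infinitely_often (R : realType) (A : set R) (F : nat -> set R)
    (g : nat -> R) (N0 : nat) :
  measurable A -> (forall j, measurable (F j)) -> (forall j, 0 <= g j) ->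
  (forall j, (N0 <= j)%N -> (mobius_law 0 (F j) <= (g j - g j.+1)%:E)%E) ->
  (forall x, 0 <= x <= 1 -> A x -> forall N, exists2 j, (N <= j)%N & F j x) ->
  mobius_law 0 A = 0%E.
Proof.
move=> mA mF g0 Fg AF; rewrite mobius_law0.
pose G j := `[0, 1] `&` F (N0 + j)%N.
have mG j : measurable (G j) by apply: measurableI.
have mL : measurable (lim_sup_set G).
  apply: bigcap_measurableType => n _; exact: bigcup_measurable.
apply/eqP; rewrite eq_le measure_ge0 andbT.
apply: (@le_trans _ _ (lebesgue_measure (lim_sup_set G))).
  apply: le_measure; rewrite ?inE//; first exact: measurableI.
  move=> x [x01 Ax] n _.
  have [j nj Fj] := AF x x01 Ax (N0 + n)%N.
  exists (j - N0)%N; first by rewrite /= leq_subRL// (leq_trans _ nj)// leq_addr.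
  by split => //; rewrite subnKC// (leq_trans _ nj)// leq_addr.
rewrite lim_sup_set_cvg0//.
apply: (@le_lt_trans _ _ (g N0)%:E); last exact: ltry.
apply: lime_le; first exact: is_cvg_nneseries.
apply: nearW => n.
apply: (@le_trans _ _ (\sum_(0 <= j < n) (g (N0 + j)%N - g (N0 + j).+1)%:E)%E).
  by apply: lee_sum => j _; have := Fg (N0 + j)%N (leq_addr _ _); rewrite mobius_law0.
rewrite sumEFin lee_fin.
under eq_bigr do rewrite -addnS -opprB.
rewrite sumrN (telescope_sumr (fun j => g (N0 + j)%N))// addn0 opprB.
by rewrite gerBl.
Qed.

(** * Elementary estimates *)

(** Comparison of x^-(q+1) with its integral over [x - 1, x], powers being exponentials of
    logarithms. It follows from 1/x <= ln x - ln (x - 1) and 1 + t <= exp t. *)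
Lemma zeta_telescope (R : realType) (q x : R) : 0 < q -> 1 < x ->
  expR (- (q + 1) * ln x) <= q^-1 * (expR (- q * ln (x - 1)) - expR (- q * ln x)).
Proof.
move=> q0 x1; have x0 : 0 < x by lra.
have xm : 0 < x - 1 by lra.
have h : x^-1 <= ln x - ln (x - 1).
  rewrite -ln_div ?posrE// -[leLHS]opprK lerNl -lnV ?posrE ?divr_gt0// invf_div.
  have -> : (x - 1) / x = 1 + - x^-1 by field; exact: lt0r_neq0.
  by apply: le_ln1Dx; rewrite ltrN2 invf_lt1.
set a := ln x in h *; set b := ln (x - 1) in h *.
have -> : - (q + 1) * a = - q * a + - a by ring.
have -> : - q * b = - q * a + q * (a - b) by ring.
have ea : expR (- a) = x^-1 by rewrite expRN lnK ?posrE.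
rewrite 2!expRD ea -ler_pdivrMl ?invr_gt0// invrK.
set u := expR (- q * a); set v := expR _.
have u0 : 0 <= u by exact: expR_ge0.
have hv : 0 <= u * (v - 1 - q * x^-1).
  apply: mulr_ge0 => //; have := expR_ge1Dx (q * (a - b)); rewrite -/v.
  have : q * x^-1 <= q * (a - b) by rewrite ler_wpM2l// ltW.
  lra.
lra.
Qed.

Lemma expr_1B_le_expR (R : realType) (a : R) (m : nat) : a <= 1 ->
  (1 - a) ^+ m <= expR (- (m%:R * a)).
Proof.
move=> a1; rewrite -mulrN expRM_natl; apply: lerXn2r; rewrite ?nnegrE ?expR_ge0 ?subr_ge0//.
exact: expR_ge1Dx.
Qed.

(** 1 - 2/(k+1) is the inverse of 1 + 2/(k-1), which is at most exp (2/(k-1)). *)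
Lemma expR_le_expr_1B (R : realType) (k m : nat) : (1 < k)%N ->
  expR (- (m%:R * (2 / (k%:R - 1)))) <= (1 - 2 / (k%:R + 1)) ^+ m :> R.
Proof.
move=> k1; have k2 : 1 < k%:R :> R by rewrite ltr1n.
rewrite -mulrN expRM_natl; apply: lerXn2r; rewrite ?nnegrE ?expR_ge0//.
  by rewrite subr_ge0 ler_pdivrMr; lra.
have -> : 1 - 2 / (k%:R + 1) = (1 + 2 / (k%:R - 1))^-1 :> R.
  by field; do ?[apply/andP; split]; apply: lt0r_neq0; lra.
have h : 0 < 2 / (k%:R - 1) :> R by apply: divr_gt0; lra.
rewrite expRN lef_pV2 ?posrE ?expR_gt0//; last lra.
exact: expR_ge1Dx.
Qed.

Lemma bernoulli_1B (R : realType) (a : R) (m : nat) : 0 <= a <= 1 ->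
  1 - (1 - a) ^+ m <= m%:R * a.
Proof.
move=> a01; elim: m => [|m IH]; first by rewrite expr0 subrr mul0r.
have h0 : 0 <= (1 - a) ^+ m by apply: exprn_ge0; lra.
have h1 : (1 - a) ^+ m <= 1 by apply: exprn_ile1; lra.
by rewrite exprS -natr1; nra.
Qed.

Lemma ln_1D_inv_ge (R : realType) (k : nat) : (0 < k)%N ->
  (k%:R + 1)^-1 <= ln (1 + 1 / k%:R) :> R.
Proof.
move=> k0; have k1 : 0 < k%:R :> R by rewrite ltr0n.
have h : 0 < 1 + 1 / k%:R :> R by apply: addr_gt0 => //; apply: divr_gt0.
rewrite -[leLHS]opprK lerNl -lnV ?posrE//.
have -> : (1 + 1 / k%:R)^-1 = 1 + - (k%:R + 1)^-1 :> R.
  by field; do ?[apply/andP; split]; apply: lt0r_neq0; lra.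
by apply: le_ln1Dx; rewrite ltrN2 invf_lt1; lra.
Qed.

Lemma ln_1D_inv_le (R : realType) (k : nat) : (0 < k)%N ->
  ln (1 + 1 / k%:R) <= k%:R^-1 :> R.
Proof.
move=> k0; have k1 : 0 < k%:R^-1 :> R by rewrite invr_gt0 ltr0n.
by rewrite div1r; apply: le_ln1Dx; lra.
Qed.

Lemma ln_fact_le (R : realType) (j : nat) : (0 < j)%N ->
  ln (j`!%:R) <= j%:R * ln j%:R :> R.
Proof.
elim: j => // -[_ _|j IH _]; first by rewrite (_ : 1`! = 1%N)// ln1 mulr0.
have pj : 0 < j.+2%:R :> R by rewrite ltr0n.
rewrite factS natrM lnM ?posrE ?ltr0n ?fact_gt0//.
apply: (@le_trans _ _ (ln j.+2%:R + j.+1%:R * ln j.+2%:R)).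
  rewrite lerD2l; apply: (le_trans (IH isT)).
  by rewrite ler_wpM2l// ler_ln ?posrE ?ltr0n// ler_nat.
by rewrite -[j.+2%:R]natr1; lra.
Qed.

Lemma natr_eventually_ge (R : realType) (c K : R) : 0 < c ->
  exists N, forall j, (N <= j)%N -> K <= c * j%:R.
Proof.
move=> c0; exists (Num.truncn (K / c)).+1 => j Nj.
rewrite mulrC -ler_pdivrMr//; apply: (@le_trans _ _ (Num.truncn (K / c)).+1%:R).
  by apply: ltW; exact: truncnS_gt.
by rewrite ler_nat.
Qed.

Lemma gauss_map_ge0 (R : realType) (x : R) : 0 <= gauss_map x.
Proof.
by rewrite /gauss_map; case: ifP => // _; rewrite subr_ge0; exact: floor_le_tmp.
Qed.

(** * The two alternatives *)

(** If the target is missed up to a time m with n_j <= m < n_(j+1), then the smaller target of time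
    n_(j+1) is missed up to time n_j. This has probability at most exp (- n_j / k(n_(j+1))) <= (c
    j)^-l, which is summable. *)
Lemma missed_orbit_null (R : realType) (k : nat -> nat) (A : set R) (C1 : R) (M0 : nat) :
  (forall m, (0 < m)%N -> (0 < k m)%N) ->
  (forall m n, (0 < m)%N -> (m <= n)%N -> (k m <= k n)%N) ->
  1 < C1 ->
  (forall m, (M0 <= m)%N -> C1 * ln (ln m%:R) / m%:R <= ln (1 + 1 / (k m)%:R)) ->
  measurable A ->
  (forall x, 0 <= x <= 1 -> A x -> forall M, exists m, [/\ (M <= m)%N, (0 < m)%N &
    forall i, (0 < i <= m)%N -> (k m)%:R^-1 < iter i (@gauss_map R) x]) ->
  mobius_law 0 A = 0%E.
Proof.
move=> k_gt0 k_nd C11 hC mA Amiss.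
(* With l = C1^(1/3), two factors l pay for the ratio n_(j+1) / n_j and its
   rounding, and the remaining one is the exponent l > 1 of a convergent series. *)
pose c := ln C1 / 3; have c0 : 0 < c by apply: divr_gt0 => //; exact: ln_gt0.
pose l := expR c.
have l1 : 1 < l by rewrite expR_gt1.
have C1l : C1 = l * l * l.
  by rewrite /l -!expRD (_ : c + c + c = ln C1) ?lnK ?posrE; [|lra|rewrite /c; field].
pose n j := Num.truncn (expR (c * j%:R)).
have n_le j : (n j)%:R <= expR (c * j%:R) by rewrite /n truncn_le// expR_ge0.
have n_gt j : expR (c * j%:R) < (n j)%:R + 1 by rewrite natr1; exact: truncnS_gt.
have n_nd : {homo n : i j / (i <= j)%N}.
  move=> i j ij; apply: le_truncn; rewrite ler_expR ler_wpM2l ?ler_nat//; exact: ltW.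
have l1V : 0 < 1 - l^-1 by rewrite subr_gt0 invf_lt1//; lra.
(* The summands ensure, in order, that the iterated logarithm is nonnegative, that n_(j+1) >= M0,
   and that truncation costs at most a factor l. *)
have [N1 hN1] := natr_eventually_ge (1 + M0%:R + (1 - l^-1)^-1) c0.
have n_ge j : (N1 <= j)%N -> expR (c * j%:R) / l <= (n j)%:R.
  move=> /hN1 hj; have hm : (1 - l^-1)^-1 <= expR (c * j%:R).
    have := expR_ge1Dx (c * j%:R); have : 0 <= M0%:R :> R by []; lra.
  have : 1 <= expR (c * j%:R) * (1 - l^-1) by rewrite -ler_pdivrMr// div1r.
  by have := n_gt j; rewrite mulrBr mulr1; lra.
have nS_ge j : (N1 <= j)%N -> expR (c * j%:R) <= (n j.+1)%:R.
  move=> Nj; have := n_ge j.+1 (leqW Nj).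
  by rewrite -natr1 mulrDr mulr1 expRD -/l mulfK// gt_eqF//; lra.
pose F j := @gauss_map R @^-1` no_hit (k (n j.+1)) (n j).
pose K := expR (- (l * ln c)).
(* Telescoping majorant of (c j)^-l from [zeta_telescope], with K = c^-l; the offset 2 below keeps j
   - 1 positive. *)
pose g j := K * ((l - 1)^-1 * expR (- (l - 1) * ln (j%:R - 1))).
apply: (@null_of_infinitely_often R A F g (N1 + 2)).
- by [].
- move=> j; rewrite -[X in measurable X]setTI; apply: measurable_gauss_map => //.
  exact: measurable_no_hit.
- by move=> j; rewrite /g !mulr_ge0 ?expR_ge0// invr_ge0; lra.
- move=> j Nj; have N1j : (N1 <= j)%N by rewrite (leq_trans _ Nj)// leq_addr.
  have j2 : 2 <= j%:R :> R by rewrite ler_nat (leq_trans _ Nj)// leq_addl.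
  have hj := hN1 j N1j.
  have M00 : 0 <= M0%:R :> R by [].
  have lV0 : 0 < (1 - l^-1)^-1 by rewrite invr_gt0.
  have hnS := nS_ge j N1j; have hnj := n_ge j N1j.
  have hx := expR_ge1Dx (c * j%:R).
  have nS0 : 0 < (n j.+1)%:R :> R by lra.
  have nS0' : (0 < n j.+1)%N by rewrite -(ltr_nat R).
  have kn0 := k_gt0 _ nS0'.
  have kR0 : 0 < (k (n j.+1))%:R :> R by rewrite ltr0n.
  have kV1 : (k (n j.+1))%:R^-1 <= 1 :> R by rewrite invf_le1// ler1n.
  have MnS : (M0 <= n j.+1)%N by rewrite -(ler_nat R); lra.
  have hk := le_trans (hC _ MnS) (ln_1D_inv_le R kn0).
  have lnn : c * j%:R <= ln (n j.+1)%:R :> R.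
    by rewrite -[leLHS]expRK ler_ln ?posrE ?expR_gt0.
  have cj0 : 0 < c * j%:R by lra.
  have lnln : ln (c * j%:R) <= ln (ln (n j.+1)%:R) by rewrite ler_ln ?posrE//; lra.
  have lnln0 : 0 <= ln (ln (n j.+1)%:R) :> R.
    have l1n : 1 <= ln (n j.+1)%:R :> R by lra.
    exact: (ln_ge0 l1n).
  have ratio : (n j.+1)%:R <= l * l * (n j)%:R.
    apply: (le_trans (n_le _)); rewrite -natr1 mulrDr mulr1 expRD -/l.
    move: hnj; rewrite ler_pdivrMr; last lra.
    move=> hnj'; have : expR (c * j%:R) * l <= (n j)%:R * l * l.
      by rewrite ler_wpM2r//; lra.
    lra.
  have expo : l * ln (c * j%:R) <= (n j)%:R * (k (n j.+1))%:R^-1.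
    apply: (@le_trans _ _ (l * ln (ln (n j.+1)%:R))); first by rewrite ler_wpM2l//; lra.
    apply: (@le_trans _ _ ((n j)%:R * (C1 * ln (ln (n j.+1)%:R) / (n j.+1)%:R))); last first.
      by rewrite ler_wpM2l.
    rewrite mulrA ler_pdivlMr// C1l.
    have -> : (n j)%:R * (l * l * l * ln (ln (n j.+1)%:R)) =
      (l * ln (ln (n j.+1)%:R)) * (l * l * (n j)%:R) by ring.
    by apply: ler_wpM2l => //; apply: mulr_ge0 => //; lra.
  apply: (le_trans (mobius_bounded_preimage 1 _ (mobius_bounded_no_hit _ kn0) _ _)) => //.
    exact: measurable_no_hit.
  rewrite lee_fin; apply: (le_trans (expr_1B_le_expR _ kV1)).
  apply: (@le_trans _ _ (expR (- (l * ln (c * j%:R))))); first by rewrite ler_expR lerN2.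
  rewrite lnM ?posrE//; last lra.
  rewrite mulrDr opprD expRD -/K /g -mulrBr -mulrBr.
  rewrite -natr1 addrK ler_wpM2l ?expR_ge0//.
  have := @zeta_telescope R (l - 1) j%:R; rewrite subrK mulNr; apply; lra.
- move=> x x01 Ax N; have [m [mM m0 hm]] := Amiss x x01 Ax (n N).
  have unb : exists j, (m < n j)%N.
    have [j hj] := natr_eventually_ge m%:R c0; exists j.
    have := hj j (leqnn j); have := expR_ge1Dx (c * j%:R); have := n_gt j.
    by rewrite -(ltr_nat R); lra.
  (* Minimality gives n_(j-1) <= m < n_j, so the event occurring is [F j.-1]. *)
  case: (ex_minnP unb) => j mj jmin.
  have Nj : (N < j)%N.
    by rewrite ltnNge; apply/negP => /n_nd jN; move: mj; rewrite ltnNge (leq_trans jN mM).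
  exists j.-1; first by rewrite -ltnS prednK// (leq_trans _ Nj).
  have j0 : (0 < j)%N by rewrite (leq_trans _ Nj).
  have njm : (n j.-1 <= m)%N.
    by rewrite leqNgt; apply/negP => /jmin; rewrite -ltnS prednK// ltnn.
  rewrite /F /preimage/= prednK// => i ij; rewrite -iterSr.
  apply: le_lt_trans (hm i.+1 _); last by rewrite /= (leq_trans ij).
  rewrite lef_pV2 ?posrE ?ltr0n ?ler_nat ?k_gt0//; last by rewrite (leq_trans _ mj).
  by apply: k_nd => //; exact: ltnW.
Qed.

(** * Zero measure: hits in successive blocks of time *)

(* Blocks are nested from the left so that the step lemma applies to the first one,
   the later ones being a preimage under an iterate of T. *)
Fixpoint block_hits (R : realType) (k m : nat -> nat) (J n : nat) : set R :=
  if n is n'.+1 then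
    hit (k J) (m J.+1 - m J) `&`
      iter (m J.+1 - m J) (@gauss_map R) @^-1` block_hits k m J.+1 n'
  else setT.

Lemma measurable_block_hits (R : realType) (k m : nat -> nat) (J n : nat) :
  measurable (@block_hits R k m J n).
Proof.
elim: n J => [|n IH] J; first exact: measurableT.
by apply: measurableI; [exact: measurable_hit|exact: measurable_iter_gauss_map].
Qed.

(** Passes from absolute times to the recursive form, where each block restarts the clock at its
    left end. *)
Lemma block_hitsP (R : realType) (k m : nat -> nat) (J n : nat) (x : R) :
  {homo m : i j / (i <= j)%N} ->
  (forall j, (J <= j)%N -> exists2 i, (m j <= i < m j.+1)%N &
    iter i (@gauss_map R) x <= (k j)%:R^-1) ->
  block_hits k m J n (iter (m J) (@gauss_map R) x).
Proof.
move=> mm; elim: n J => [//|n IH] J hx; split.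
  have [i /andP[mi im] hi] := hx J (leqnn J).
  exists (i - m J)%N; first by rewrite ltn_sub2r// (leq_ltn_trans mi).
  by rewrite -iterD subnK.
rewrite /preimage/= -iterD subnK; last exact: mm.
by apply: IH => j Jj; apply: hx; exact: ltnW.
Qed.

(* The bound is the product of the exp (- kappa / j.+1), the sum of the 1 / j.+1 being
   bounded below by a difference of logarithms. *)
Lemma mobius_bounded_block_hits (R : realType) (k m : nat -> nat) (kappa : R)
    (J n : nat) :
  0 <= kappa ->
  (forall j, (J <= j)%N -> (0 < k j)%N /\
    kappa / j.+1%:R <= (1 - 2 / ((k j)%:R + 1)) ^+ (m j.+1 - m j)) ->
  mobius_bounded (@block_hits R k m J n)
    (expR (- (kappa * (ln (J.+1 + n)%:R - ln J.+1%:R)))).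
Proof.
move=> kap0; elim: n J => [|n IH] J hJ.
  by rewrite addn0 subrr mulr0 oppr0 expR0; exact: mobius_bounded_setT.
have [k0 hk] := hJ J (leqnn J).
have := mobius_bounded_hit (m J.+1 - m J)%N k0 (@measurable_block_hits R k m J.+1 n)
   (IH _ (fun j Jj => hJ j (ltnW Jj))).
move=> h s s0 s1; apply: (le_trans (h s s0 s1)); rewrite lee_fin.
set p := _ ^+ _ in hk *.
have J0 : 0 < J.+1%:R :> R by rewrite ltr0n.
have J1 : 0 < J.+2%:R :> R by rewrite ltr0n.
have hln : ln J.+2%:R - ln J.+1%:R <= J.+1%:R^-1 :> R.
  rewrite -ln_div ?posrE// -[J.+2%:R]natr1 mulrDl divff ?gt_eqF// mul1r.
  by apply: le_ln1Dx; apply: lt_trans (_ : 0 < _); rewrite ?ltrN10 ?invr_gt0.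
have h1 : 1 - p <= expR (- (kappa * (ln J.+2%:R - ln J.+1%:R))).
  apply: le_trans (expR_ge1Dx _); rewrite lerD2l lerN2.
  by apply: le_trans hk; rewrite ler_wpM2l.
rewrite mulrC.
apply: (@le_trans _ _ (expR (- (kappa * (ln J.+2%:R - ln J.+1%:R))) *
   expR (- (kappa * (ln (J.+2 + n)%:R - ln J.+2%:R))))).
  by rewrite ler_wpM2r ?expR_ge0.
rewrite -expRD addSnnS le_eqVlt; apply/orP; left; apply/eqP; congr expR; ring.
Qed.

(** The bound for n blocks is ((J + 1 + n) / (J + 1))^-kappa, which tends to 0 as n grows. *)
Lemma block_hits_null (R : realType) (k m : nat -> nat) (kappa : R) (J : nat)
    (A : set R) :
  0 < kappa ->
  (forall j, (J <= j)%N -> (0 < k j)%N /\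
    kappa / j.+1%:R <= (1 - 2 / ((k j)%:R + 1)) ^+ (m j.+1 - m j)) ->
  measurable A ->
  (forall x n, A x -> block_hits k m J n (iter (m J).+1 (@gauss_map R) x)) ->
  mobius_law 0 A = 0%E.
Proof.
move=> kap0 hJ mA Ah; apply/eqP; rewrite eq_le measure_ge0 andbT.
apply/lee_addgt0Pr => e e0; rewrite add0e.
(* Once n exceeds this value, the bound for n blocks is at most e. *)
pose z := expR (ln J.+1%:R + ln e^-1 / kappa).
pose n := (Num.truncn z).+1.
have hz : ln J.+1%:R + ln e^-1 / kappa <= ln (J.+1 + n)%:R.
  rewrite -[leLHS]expRK ler_ln ?posrE ?expR_gt0 ?ltr0n ?addn_gt0//.
  apply: (@le_trans _ _ n%:R); first by apply: ltW; exact: truncnS_gt.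
  by rewrite ler_nat leq_addl.
have := mobius_bounded_preimage (m J).+1 (@measurable_block_hits R k m J n)
  (mobius_bounded_block_hits n (ltW kap0) hJ) (lexx 0) ler01.
move=> h; apply: (@le_trans _ _ _ _ _ (le_trans _ h)).
  apply: le_mobius_law => //.
    by apply: measurable_iter_gauss_map; exact: measurable_block_hits.
  by move=> x _ Ax; exact: Ah.
rewrite lee_fin -[leRHS]lnK ?posrE// ler_expR lerNl.
have -> : - ln e = ln e^-1 by rewrite lnV ?posrE.
by rewrite mulrC -ler_pdivrMr// lerBrDl.
Qed.

(** A hit before time m_(j+1) occurs either before m_j (event [F j], of summable probability) or
    inside block j. If the former happens only finitely often, all blocks from some index on are hit
    (event [D], of measure zero). Borel-Cantelli is applied to the union of both. *)
Lemma orbit_hits_null (R : realType) (k m : nat -> nat) (kappa C : R) (A : set R)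
    (N0 : nat) :
  0 < kappa -> 0 <= C -> {homo m : i j / (i <= j)%N} ->
  (forall j, (j <= m j)%N) ->
  (forall j, (N0 <= j)%N -> (0 < k j)%N /\
    kappa / j.+1%:R <= (1 - 2 / ((k j)%:R + 1)) ^+ (m j.+1 - m j)) ->
  (forall j, (N0 <= j)%N ->
    (m j)%:R * (2 / ((k j)%:R + 1)) <= C / j%:R - C / j.+1%:R) ->
  measurable A ->
  (forall x, A x -> exists M0, forall j, (M0 <= m j.+1)%N ->
     exists2 i, (i < m j.+1)%N & iter i.+1 (@gauss_map R) x <= (k j)%:R^-1) ->
  mobius_law 0 A = 0%E.
Proof.
move=> kap0 C0 mm mge hp hs mA Ahit.
pose T := @gauss_map R.
pose F j := T @^-1` hit (k j) (m j).
pose D j := \bigcap_n (iter (m j).+1 T @^-1` block_hits k m j n).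
have mF j : measurable (F j).
  by apply: (@measurable_iter_gauss_map R 1); exact: measurable_hit.
have mD j : measurable (D j).
  apply: bigcap_measurableType => n _; apply: measurable_iter_gauss_map.
  exact: measurable_block_hits.
apply: (@null_of_infinitely_often R A (fun j => F j `|` D j) (fun j => C / j%:R) N0) => //.
- by move=> j; exact: measurableU.
- by move=> j; rewrite divr_ge0.
- move=> j Nj; apply: (le_trans (mobius_lawU _ _ _)) => //.
  have -> : mobius_law 0 (D j) = 0%E.
    apply: (@block_hits_null R k m kappa j) => //.
      by move=> i ji; apply: hp; exact: leq_trans ji.
    by move=> x n /(_ n I).
  have [k0 _] := hp j Nj; rewrite adde0.
  have k1 : 1 <= (k j)%:R :> R by rewrite ler1n.
  apply: (le_trans (mobius_bounded_preimage 1 (@measurable_hit R (k j) (m j)) _ (lexx 0) ler01)).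
    move=> s s0 s1; have := mobius_bounded_hit (m j) k0 measurableT (@mobius_bounded_setT R) s0 s1.
    by rewrite preimage_setT setIT mul1r; exact.
  rewrite lee_fin; apply: le_trans (hs j Nj); apply: bernoulli_1B.
  by rewrite divr_ge0 ?ler_pdivrMr/=; lra.
- move=> x _ Ax N.
  have [[j Nj Fj]|nF] := pselect (exists2 j, (N <= j)%N & F j x).
    by exists j => //; left.
  have [M0 hM] := Ahit x Ax.
  exists (maxn N M0); first exact: leq_maxl.
  right => n _.
  suff : block_hits k m (maxn N M0) n (iter (m (maxn N M0)) T (T x)) by rewrite -iterSr.
  apply: block_hitsP => // j.
  rewrite geq_max => /andP[Nj Mj].
  have [i im hi] := hM j (leq_trans Mj (leq_trans (leqnSn j) (mge _))).
  exists i; last by rewrite -iterSr.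
  rewrite im andbT leqNgt; apply/negP => ij; apply: nF; exists j => //.
  by exists i => //; rewrite -iterSr.
Qed.

(** From ln j! <= j ln j and ln j <= j^eps / eps: the logarithm is absorbed by a small increase of
    the exponent of j. *)
Lemma factorial_scale_log_bound (R : realType) (eps : R) (j : nat) :
  0 < eps -> (0 < j)%N ->
  ln ((j`! ^ 4)%N%:R) <= 4 / eps * expR ((1 + eps) * ln j%:R) :> R.
Proof.
move=> e0 j0; have jR : 0 < j%:R :> R by rewrite ltr0n.
rewrite natrX lnXn ?ltr0n ?fact_gt0// -[_ *+ 4]mulr_natl.
have -> : (1 + eps) * ln j%:R = ln j%:R + eps * ln j%:R by ring.
rewrite expRD lnK ?posrE//.
have h1 := ln_fact_le R j0.
have h2 : ln j%:R <= eps^-1 * expR (eps * ln j%:R).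
  rewrite ler_pdivlMl//; have := expR_ge1Dx (eps * ln j%:R); lra.
have h3 : j%:R * ln j%:R <= j%:R * (eps^-1 * expR (eps * ln j%:R)) by rewrite ler_wpM2l.
lra.
Qed.

Lemma frequent_hits_null (R : realType) (k : nat -> nat) (A : set R) (C2 : R) :
  k m @[m --> \oo] --> \oo ->
  C2 < 1 / 2 ->
  (\forall m \near \oo, ln (1 + 1 / (k m)%:R) <= C2 * ln (ln m%:R) / m%:R) ->
  measurable A ->
  (forall x, A x -> exists M, forall m, (M <= m)%N ->
     exists2 i, (0 < i <= m)%N & iter i (@gauss_map R) x <= (k m)%:R^-1) ->
  mobius_law 0 A = 0%E.
Proof.
move=> k_cvg C2h hC mA Ahit.
(* C2 may be nonpositive; c is a positive constant still below 1/2. *)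
pose c := Num.max C2 (1 / 4).
have c0 : 1 / 4 <= c by rewrite /c le_max lexx orbT.
have cC : C2 <= c by rewrite /c le_max lexx.
have ch : c < 1 / 2 by rewrite /c gt_max C2h/=; lra.
(* The midpoint of 2c and 1. The gap above 2c pays for replacing k + 1 by k - 1, the gap below 1 for
   the [eps] in the growth of ln m_j, through th (1 + eps) = 1. *)
pose th := (1 + 2 * c) / 2.
have thc : 2 * c < th by rewrite /th; lra.
have th1 : th < 1 by rewrite /th; lra.
pose eps := th^-1 - 1.
have eps0 : 0 < eps by rewrite /eps subr_gt0 invf_gt1//; lra.
have theps : th * (1 + eps) = 1 by rewrite /eps addrC subrK mulfV// gt_eqF//; lra.
(* For k >= K one has (k + 1) / (k - 1) <= th / (2c). *)
pose K := (2 + Num.truncn (4 * c / (th - 2 * c)))%N.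
have [M1 _ hM1] : \forall m \near \oo,
    [/\ ln (1 + 1 / (k m)%:R) <= C2 * ln (ln m%:R) / m%:R, (K <= k m)%N
      & (Num.truncn (expR 1 : R) < m)%N].
  near=> m; split; near: m => //.
    exact: (k_cvg _ (nbhs_infty_ge K)).
have main m : (M1 <= m)%N -> [/\ (1 < k m)%N, 1 <= ln m%:R :> R,
    m%:R * (2 / ((k m)%:R + 1)) <= ln (ln m%:R) :> R &
    m%:R * (2 / ((k m)%:R - 1)) <= th * ln (ln m%:R) :> R].
  move=> /hM1 [hk Kk me].
  have k1 : (1 < k m)%N by rewrite (leq_trans _ Kk).
  have kR : 2 <= (k m)%:R :> R by rewrite ler_nat.
  have me1 : expR 1 <= m%:R :> R.
    apply: ltW; apply: (lt_le_trans (truncnS_gt _)); by rewrite ler_nat.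
  have m0 : 0 < m%:R :> R by apply: lt_le_trans me1; exact: expR_gt0.
  have lm : 1 <= ln m%:R :> R by rewrite -[leLHS]expRK ler_ln ?posrE ?expR_gt0.
  have ll : 0 <= ln (ln m%:R) :> R by exact: ln_ge0.
  have b1 : (k m)%:R + 1 != 0 :> R by rewrite gt_eqF//; lra.
  have b2 : (k m)%:R - 1 != 0 :> R by rewrite gt_eqF//; lra.
  have hk1 : m%:R * ((k m)%:R + 1)^-1 <= c * ln (ln m%:R) :> R.
    rewrite mulrC -ler_pdivlMr//; apply: (le_trans (ln_1D_inv_ge R (ltnW k1))).
    by apply: (le_trans hk); rewrite ler_pM2r ?invr_gt0// ler_wpM2r.
  have hd : 2 / ((k m)%:R - 1) <= th / (2 * c) - 1 :> R.
    have hK : 4 * c / (th - 2 * c) <= (k m)%:R - 1 :> R.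
      have : (2 + Num.truncn (4 * c / (th - 2 * c)))%N%:R <= (k m)%:R :> R.
        by rewrite ler_nat.
      have := truncnS_gt (4 * c / (th - 2 * c)); rewrite -natr1 natrD; lra.
    have -> : th / (2 * c) - 1 = (th - 2 * c) / (2 * c) by field; rewrite gt_eqF//; lra.
    rewrite ler_pdivrMr; last lra.
    rewrite mulrAC ler_pdivlMr; last lra.
    move: hK; rewrite ler_pdivrMr; lra.
  split => //; first by rewrite mulrCA; nra.
  have -> : 2 / ((k m)%:R - 1) = 2 * ((k m)%:R + 1)^-1 * (1 + 2 / ((k m)%:R - 1)) :> R.
    by field; rewrite b1 b2.
  have -> : th * ln (ln m%:R) = (2 * (c * ln (ln m%:R))) * (th / (2 * c)) :> R.
    by field; rewrite gt_eqF//; lra.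
  rewrite mulrA mulrCA; apply: ler_pM.
  - by rewrite !mulr_ge0// invr_ge0; lra.
  - by apply: addr_ge0 => //; apply: divr_ge0; lra.
  - by rewrite ler_wpM2l.
  - lra.
(* The ratio m_(j+1) / m_j = (j+1)^4 leaves a summable (j+1)^-2 even after the crude bound 4 (j+1)^2
   on the iterated logarithm, while ln m_j grows nearly linearly, so missing a block costs only
   about 1/(j+1). *)
pose m j := (j`! ^ 4)%N.
have mS j : m j.+1 = (j.+1 ^ 4 * m j)%N by rewrite /m factS expnMn.
have m_gt0 j : (0 < m j)%N by rewrite expn_gt0 fact_gt0.
have mm : {homo m : i j / (i <= j)%N}.
  by move=> i j ij; rewrite leq_exp2r//; exact: leq_fact.
have mge j : (j <= m j)%N.
  case: j => // j; rewrite mS (leq_trans _ (leq_pmulr _ (m_gt0 j)))//.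
  by rewrite -[leqLHS]expn1 leq_pexp2l.
pose kap := expR (- (th * ln (4 / eps))).
apply: (@orbit_hits_null R (fun j => k (m j.+1)) m kap 4 A (M1 + 1)) => //.
- exact: expR_gt0.
- move=> j Mj; have MJ : (M1 <= m j.+1)%N.
    by rewrite (leq_trans _ (mge _))// (leq_trans _ (leqnSn j))// (leq_trans _ Mj)// leq_addr.
  have [k1 lm _ h2] := main _ MJ.
  have kR : 2 <= (k (m j.+1))%:R :> R by rewrite ler_nat.
  split; first exact: ltnW.
  have b1 : 2 / ((k (m j.+1))%:R + 1) <= 1 :> R by rewrite ler_pdivrMr; lra.
  have b0 : 0 <= 2 / ((k (m j.+1))%:R + 1) :> R by apply: divr_ge0; lra.
  (* Lengthening the block to all m_(j+1) times only lowers the probability of a miss. *)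
  apply: (@le_trans _ _ ((1 - 2 / ((k (m j.+1))%:R + 1)) ^+ m j.+1)); last first.
    by apply: ler_wiXn2l; [lra|lra|exact: leq_subr].
  apply: le_trans (expR_le_expr_1B R (m j.+1) k1).
  have jR : 0 < j.+1%:R :> R by rewrite ltr0n.
  have -> : kap / j.+1%:R = expR (- (th * ln (4 / eps)) - ln j.+1%:R).
    by rewrite expRD expRN lnK ?posrE.
  rewrite ler_expR -opprD lerN2; apply: (le_trans h2).
  have h3 := factorial_scale_log_bound eps0 (ltn0Sn j).
  (* The relation th (1 + eps) = 1 yields exactly the power 1/(j+1), whose series diverges. *)
  have -> : th * ln (4 / eps) + ln j.+1%:R = th * (ln (4 / eps) + (1 + eps) * ln j.+1%:R).
    by rewrite mulrDr mulrA theps mul1r.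
  rewrite ler_wpM2l//; first lra.
  have e4 : 0 < 4 / eps by apply: divr_gt0.
  rewrite -[X in _ + X]expRK -lnM ?posrE ?expR_gt0// ler_ln ?posrE//; first lra.
  by rewrite mulr_gt0 ?expR_gt0.
- move=> j Mj; have MJ : (M1 <= m j.+1)%N.
    by rewrite (leq_trans _ (mge _))// (leq_trans _ (leqnSn j))// (leq_trans _ Mj)// leq_addr.
  have [k1 lm h1 _] := main _ MJ.
  have j0 : 0 < j%:R :> R by rewrite ltr0n (leq_trans _ Mj)// addn1.
  have mj0 : 0 < (m j)%:R :> R by rewrite ltr0n.
  set J := j.+1%:R : R; have JE : J = j%:R + 1 by rewrite natr1.
  have J0 : 0 < J by lra.
  have hl : ln (m j.+1)%:R <= 4 * (J * J) :> R.
    rewrite /m natrX lnXn ?ltr0n ?fact_gt0// -[_ *+ 4]mulr_natl ler_wpM2l//.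
    apply: (le_trans (ln_fact_le R _)) => //; rewrite ler_wpM2l//.
    by apply: ltW; exact: ln_sublinear.
  have hll : ln (ln (m j.+1)%:R) <= 4 * (J * J) :> R.
    by apply: le_trans hl; apply: ltW; apply: ln_sublinear; lra.
  have h4 : J ^+ 4 * ((m j)%:R * (2 / ((k (m j.+1))%:R + 1))) <= 4 * (J * J).
    have eJ : J ^+ 4 * (m j)%:R = (m j.+1)%:R by rewrite mS natrM natrX.
    by apply: le_trans hll; move: h1; rewrite -{1}eJ -mulrA.
  apply: (@le_trans _ _ (4 * (J * J) / J ^+ 4)).
    by rewrite ler_pdivlMr ?exprn_gt0// mulrC.
  have -> : 4 * (J * J) / J ^+ 4 = 4 / J / J by field; rewrite gt_eqF.
  have -> : 4 / j%:R - 4 / J = 4 / J / j%:R.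
    by rewrite JE; field; rewrite !gt_eqF//; lra.
  rewrite ler_wpM2l ?divr_ge0 ?(ltW J0)// lef_pV2 ?posrE//; lra.
- move=> x Ax; have [M hM] := Ahit x Ax; exists M => j Mj.
  have [[//|i] im hi] := hM _ Mj; by exists i.
Unshelve. all: by end_near.
Qed.

(** * The two alternatives for the Gauss measure *)

Theorem corollary1p7 (R : realType) (k : nat -> nat)
    (k_gt0 : forall m : nat, (0 < m)%N -> (0 < k m)%N)
    (k_nondecreasing : forall m n : nat, (0 < m)%N -> (m <= n)%N -> (k m <= k n)%N)
    (k_cvg : k m @[m --> \oo] --> \oo) :
  let B (m : nat) : set R := `[0, 1 / (k m)%:R]%classic in
  let H_ea : set R := eventually_always_hitting `[0, 1] (@gauss_map R) B in
  ((exists2 C1 : R, 1 < C1 &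
      \forall m \near \oo,
        ln (1 + 1 / (k m)%:R) >= C1 * ln (ln m%:R) / m%:R) ->
    gauss_measure H_ea = 1%E)
  /\
  ((exists2 C2 : R, C2 < 1 / 2 &
      \forall m \near \oo,
        ln (1 + 1 / (k m)%:R) <= C2 * ln (ln m%:R) / m%:R) ->
    gauss_measure H_ea = 0%E).
Proof.
move=> B H.
have mT := @measurable_gauss_map R.
have mH : measurable H.
  by apply: measurable_eventually_always_hitting => // m; exact: measurable_itv.
split=> [[C1 C11 [M0 _ hC]]|[C2 C2h hC]].
  have nullC : mobius_law 0 (~` H) = 0%E.
    apply: (missed_orbit_null k_gt0 k_nondecreasing C11 hC); first exact: measurableC.
    move=> x x01 nHx M; apply: contrapT => nm; apply: nHx; split; first by rewrite /= in_itv.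
    (* Starting at M + 1 makes the missed time m positive. *)
    exists M.+1 => // m /= Mm; apply: contrapT => nhit; apply: nm; exists m.
    split; [exact: ltnW|exact: leq_ltn_trans Mm|move=> i im].
    rewrite ltNge; apply/negP => hi; apply: nhit; exists (iter i (@gauss_map R) x).
    split; first by exists i.
    rewrite /B /= in_itv/= div1r hi andbT.
    (* As i >= 1, the iterate is a value of the Gauss map, hence nonnegative. *)
    by case: i im {hi} => // i _; exact: gauss_map_ge0.
  have nullG := gauss_measure_null (measurableC mH) nullC.
  rewrite -[H]setCK probability_setC; last exact: measurableC.
  by transitivity (1 - gauss_measure (~` H))%E => //; rewrite nullG sube0.
apply: gauss_measure_null => //.
apply: (frequent_hits_null k_cvg C2h hC mH) => x [_ [M _ hM]].
exists M => m /hM [_ [[i im <-] Bi]]; exists i => //.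
by move: Bi; rewrite /B /= in_itv/= div1r => /andP[].
Qed.
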